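(* Let $\{a_{ij}\}_{j\in\mathcal J_i}$ be a finite nonempty family of nonzero vectors in $\mathbb R^2$, let $G$ be the largest angular gap between consecutive directions (including wrap-around), and suppose $G\le\pi$. Call $\mathcal K\subseteq\mathcal J_i$ cone-covering if $a_{ij}\in\operatorname{cone}\{a_{ik}\}_{k\in\mathcal K}$ for every $j\in\mathcal J_i$. (i) If $G<\pi$, then $\operatorname{cone}\{a_{ij}\}_{j\in\mathcal J_i}=\mathbb R^2$, and consequently the retained directions $\{a_{ik}\}_{k\in\mathcal K}$ of any cone-covering $\mathcal K$ positively span $\mathbb R^2$. (ii) If $G=\pi$, then $\operatorname{cone}\{a_{ij}\}_{j\in\mathcal J_i}$ is a line if the vectors are collinear, and a closed half-plane otherwise. In the collinear case two antiparallel retained rays are sufficient for cone coverage; in the other case every cone-covering $\mathcal K$ has at least three elements. (iii) Suppose $|\mathcal J_i|\ge3$ and consider the following procedure: start with $K=3$; for the current $K$, a selector proposes a retained set $\mathcal K\subseteq\mathcal J_i$ of cardinality $K$, which is accepted only if it is cone-covering; if it is not, $K$ is increased by one and a new candidate is proposed. The procedure terminates no later than $K=|\mathcal J_i|$, where the retained set is the full set $\mathcal J_i$ and cone coverage holds trivially.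
   Context: $\operatorname{cone}\{v_1,\dots,v_K\}=\{\sum_k\mu_kv_k:\mu_k\ge0\}$; vectors positively span $\mathbb R^2$ if their cone is $\mathbb R^2$. Angular gaps: write the polar angles of the vectors in sorted order $\theta_1\le\cdots\le\theta_m$ in $[0,2\pi)$; the gaps are $\theta_{l+1}-\theta_l$ for $1\le l<m$ and the wrap-around gap $\theta_1+2\pi-\theta_m$; $G$ is the largest of these. Retained directions are always selected from the original family; the selector is an arbitrary rule. *)

(* Defs.v *)
From HB Require Import structures.
From mathcomp Require Import all_boot all_order all_algebra.
From mathcomp Require Import all_classical all_reals all_analysis.
From mathcomp Require Import ring lra.

Set Implicit Arguments.
Unset Strict Implicit.
Unset Printing Implicit Defensive.

Import Order.TTheory GRing.Theory Num.Theory.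

Local Open Scope classical_set_scope.
Local Open Scope ring_scope.

Section Cones.
Context {R : realType} {J : finType}.
Implicit Types (a : J -> 'rV[R]_2) (K : {set J}) (u v : 'rV[R]_2).

(* The empty sum is allowed: the cone of the empty subfamily is {0}. *)
Definition cone a K : set 'rV[R]_2 :=
  [set v | exists mu : J -> R,
    (forall k, k \in K -> 0 <= mu k) /\ v = \sum_(k in K) mu k *: a k].

Definition positively_span a K : Prop := cone a K = setT.

Definition cone_covering a K : Prop := forall j, cone a K (a j).

(* Collinearity as vectors: all members lie on one line through the origin. *)
Definition collinear a : Prop :=
  exists2 u, u != 0 & forall j, exists c : R, a j = c *: u.

Definition antiparallel u v : Prop :=
  u != 0 /\ exists2 c : R, 0 < c & v = - c *: u.

(* Only lines through 0, and half-planes whose boundary contains 0: no other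
   line or half-plane is a cone. *)
Definition is_line (L : set 'rV[R]_2) : Prop :=
  exists2 u, u != 0 & L = [set v | exists c : R, v = c *: u].

Definition is_closed_half_plane (H : set 'rV[R]_2) : Prop :=
  exists2 n : 'rV[R]_2, n != 0 & H = [set v | 0 <= (n *m v^T) 0 0].

End Cones.

Section Angles.
Context {R : realType}.

Definition is_polar_angle (v : 'rV[R]_2) (t : R) : Prop :=
  0 <= t < 2 * pi /\
  exists2 r : R, 0 < r & v 0 0 = r * cos t /\ v 0 1 = r * sin t.

(* The default value 0 is only used for v = 0, see polar_angleP. *)
Definition polar_angle (v : 'rV[R]_2) : R := xget 0 (is_polar_angle v).

Lemma is_polar_angle_inj (v : 'rV[R]_2) (s t : R) :
  is_polar_angle v s -> is_polar_angle v t -> s = t.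
Proof.
wlog st : s t / s <= t.
  by case: (leP s t) => [|/ltW] st H ? ?; [|apply/esym]; apply: (H _ _ st).
move=> [/andP[s0 s2] [r r0 [xr yr]]] [/andP[t0 t2] [q q0 [xq yq]]].
have rq : r = q.
  apply/eqP; rewrite -(eqrXn2 (n := 2)) ?ltW //; apply/eqP.
  rewrite -[LHS]mulr1 -[RHS]mulr1 -{1}(cos2Dsin2 s) -(cos2Dsin2 t) !mulrDr.
  by rewrite -!exprMn -xr -yr xq yq.
have ec : cos s = cos t.
  by apply: (mulfI (lt0r_neq0 q0)); rewrite -xq -rq.
have es : sin s = sin t.
  by apply: (mulfI (lt0r_neq0 q0)); rewrite -yq -rq.
have cd : cos (t - s) = 1 by rewrite cosB ec es -!expr2 cos2Dsin2.
have : sin ((t - s) / 2) = 0.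
  have e : t - s = ((t - s) / 2) *+ 2 by rewrite -mulr_natr divfK ?pnatr_eq0.
  have c1 : cos ((t - s) / 2) ^+ 2 *+ 2 - 1 = 1 by rewrite -cos_mulr2n -e.
  have := cos2Dsin2 ((t - s) / 2) => cs.
  by apply/eqP; rewrite -sqrf_eq0; apply/eqP; lra.
move=> sd; apply/eqP/negPn/negP => neq.
have lt_st : s < t by rewrite lt_neqAle neq.
suff : 0 < sin ((t - s) / 2) by rewrite sd ltxx.
by apply: sin_gt0_pi; apply/andP; split; lra.
Qed.

Lemma polar_angleP (v : 'rV[R]_2) :
  v != 0 -> is_polar_angle v (polar_angle v).
Proof.
move=> v0; apply: xgetPex.
have q0 : 0 < v 0 0 ^+ 2 + v 0 1 ^+ 2.
  rewrite lt0r addr_ge0 ?sqr_ge0 // andbT paddr_eq0 ?sqr_ge0 // !sqrf_eq0.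
  apply: contra v0 => /andP[/eqP x0 /eqP y0]; apply/eqP/rowP => i.
  rewrite mxE; case: i => [[|[|//]]] ilt.
    by rewrite -[RHS]x0; congr (v 0 _); apply: val_inj.
  by rewrite -[RHS]y0; congr (v 0 _); apply: val_inj.
pose r := Num.sqrt (v 0 0 ^+ 2 + v 0 1 ^+ 2).
have r0 : 0 < r by rewrite sqrtr_gt0.
have r2 : r ^+ 2 = v 0 0 ^+ 2 + v 0 1 ^+ 2 by rewrite sqr_sqrtr // ltW.
pose c := v 0 0 / r.
have xE : v 0 0 = r * c by rewrite mulrC divfK // lt0r_neq0.
have dE : 1 - c ^+ 2 = (v 0 1 / r) ^+ 2.
  rewrite /c !expr_div_n.
  have -> : v 0 1 ^+ 2 = r ^+ 2 - v 0 0 ^+ 2 :> R by rewrite r2 addrC addKr.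
  by rewrite mulrBl divff // expf_neq0 // lt0r_neq0.
have c1 : -1 <= c <= 1.
  rewrite -ler_norml -(@ler_pXn2r _ 2) ?nnegrE // expr1n real_normK ?num_real //.
  by rewrite -subr_ge0 dE sqr_ge0.
have cK : cos (acos c) = c by rewrite acosK // in_itv.
have sE : r * sin (acos c) = `|v 0 1|.
  rewrite sin_acos // dE sqrtr_sqr normrM normfV (gtr0_norm r0) mulrC divfK //.
  exact: lt0r_neq0.
have [a0 a1] := (acos_ge0 c1, acos_lepi c1).
have p0 : 0 < pi :> R := pi_gt0 R.
case: (leP 0 (v 0 1)) => y0.
  exists (acos c); split; first by apply/andP; split; lra.
  by exists r => //; rewrite cK sE ger0_norm.
exists (2 * pi - acos c); split.
  have : acos c != 0.
    apply/eqP => e; move: sE; rewrite e sin0 mulr0 ltr0_norm //; lra.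
  move=> an0; have : 0 < acos c by rewrite lt0r an0.
  by move=> ?; apply/andP; split; lra.
exists r => //; rewrite mulr_natl addrC cosD2pi sinD2pi cosN sinN cK -xE.
by rewrite mulrN sE ltr0_norm // opprK.
Qed.

Definition sorted_angles {J : finType} (a : J -> 'rV[R]_2) : seq R :=
  sort <=%R [seq polar_angle (a j) | j <- enum J].

(* The last entry is the wrap-around gap; for a singleton it is the only one,
   and equals 2 * pi. *)
Definition angular_gaps (s : seq R) : seq R :=
  rcons [seq s`_l.+1 - s`_l | l <- iota 0 (size s).-1]
        (head 0 s + 2 * pi - last 0 s).

(* All gaps of a sorted sequence in [0, 2 * pi[ are nonnegative, so starting
   the maximum at 0 is harmless. *)
Definition largest_gap {J : finType} (a : J -> 'rV[R]_2) : R :=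
  \big[Num.max/0]_(g <- angular_gaps (sorted_angles a)) g.

End Angles.

Section Procedure.
Context {R : realType} {J : finType}.
Implicit Types (a : J -> 'rV[R]_2) (h : seq {set J}) (K : nat).

(* [sel h K] is the candidate proposed at the current value K, given the list h
   of the candidates rejected so far. *)
Definition valid_selector (sel : seq {set J} -> nat -> {set J}) : Prop :=
  forall h K, (3 <= K <= #|J|)%N -> #|sel h K| = K.

(* States (rejected candidates, current K) visited by the procedure; it stops
   at the first state whose candidate is cone-covering. *)
Inductive reached a (sel : seq {set J} -> nat -> {set J}) :
    seq {set J} -> nat -> Prop :=
| reached_start : reached a sel [::] 3
| reached_next h K :
    reached a sel h K -> ~ cone_covering a (sel h K) ->
    reached a sel (rcons h (sel h K)) K.+1.

Definition accepted_at a (sel : seq {set J} -> nat -> {set J}) h K : Prop :=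
  reached a sel h K /\ cone_covering a (sel h K).

End Procedure.

(* Main.v *)
Require Import Defs.
From HB Require Import structures.
From mathcomp Require Import all_boot all_order all_algebra.
From mathcomp Require Import all_classical all_reals all_analysis.
From mathcomp Require Import ring lra.

Set Implicit Arguments.
Unset Strict Implicit.
Unset Printing Implicit Defensive.

Import Order.TTheory GRing.Theory Num.Theory.

Local Open Scope ring_scope.

(** If the largest gap is below [pi], every direction lies in a sector, of
    opening less than [pi], between two consecutive members of the family, hence
    in their cone. If it equals [pi], the two members bounding such a gap are
    antiparallel, and the whole family lies in the closed half-plane opposite
    the gap, so that part (ii) becomes linear algebra with the functional whose
    kernel is the common line of these two members. *)

(** * Plane vectors: determinants, directions and sectors *)

Section PlaneVectors.
Context {R : realType}.
Implicit Types (u v w n : 'rV[R]_2) (s t : R).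

Definition dot n v : R := (n *m v^T) 0 0.

(* Clockwise rotation by a right angle: [dot (perp u) v] is the determinant of
   the pair [(v, u)]. *)
Definition perp u : 'rV[R]_2 := \row_i (if i == 0 then u 0 1 else - u 0 0).

Lemma row2P u v : u 0 0 = v 0 0 -> u 0 1 = v 0 1 -> u = v.
Proof.
move=> e0 e1; apply/rowP => -[[|[|//]] lti].
  by have -> : Ordinal lti = 0 by apply: val_inj.
by have -> : Ordinal lti = 1 by apply: val_inj.
Qed.

Lemma dotE n v : dot n v = n 0 0 * v 0 0 + n 0 1 * v 0 1.
Proof.
rewrite /dot mxE big_ord_recl big_ord1 !mxE.
by congr (_ + n 0 _ * v 0 _); apply: val_inj.
Qed.

Lemma dot_perpE u v : dot (perp u) v = u 0 1 * v 0 0 - u 0 0 * v 0 1.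
Proof. by rewrite dotE !mxE /= mulNr. Qed.

Lemma dotDr n v w : dot n (v + w) = dot n v + dot n w.
Proof. by rewrite !dotE !mxE; ring. Qed.

Lemma dotZr n (c : R) v : dot n (c *: v) = c * dot n v.
Proof. by rewrite !dotE !mxE; ring. Qed.

Lemma dot_sumr n (I : finType) (P : pred I) (F : I -> 'rV[R]_2) :
  dot n (\sum_(i | P i) F i) = \sum_(i | P i) dot n (F i).
Proof.
apply: (big_morph (dot n)) => [v w|]; first exact: dotDr.
by rewrite dotE !mxE !mulr0 addr0.
Qed.

Lemma dot_gt0 u : u != 0 -> 0 < dot u u.
Proof.
move=> u0; rewrite dotE -!expr2 lt0r addr_ge0 ?sqr_ge0 // andbT.
rewrite paddr_eq0 ?sqr_ge0 // !sqrf_eq0; apply: contra u0 => /andP[/eqP e0 /eqP e1].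
by apply/eqP/row2P; rewrite mxE.
Qed.

Lemma perp_neq0 u : u != 0 -> perp u != 0.
Proof.
apply: contra => /eqP/rowP e; apply/eqP/row2P; rewrite mxE.
  by have := e 1; rewrite !mxE /= => /eqP; rewrite oppr_eq0 => /eqP.
by have := e 0; rewrite !mxE.
Qed.

(** Cramer's rule for [w] in terms of [v] and [u], kept free of division so that it also holds when
    [u] and [v] are dependent. *)
Lemma dot_perp_decomp u v w :
  dot (perp u) v *: w =
  dot (perp u) w *: v + dot (perp w) v *: u.
Proof. by apply: row2P; rewrite !mxE !dot_perpE; ring. Qed.

Lemma dot_perp_eq0 u v : u != 0 -> dot (perp u) v = 0 -> exists c : R, v = c *: u.
Proof.
move=> u0 e; have /lt0r_neq0 q0 := dot_gt0 (perp_neq0 u0).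
(* With [perp u] as third vector, the coefficient of [v] is the squared norm of [perp u], hence
   invertible. *)
have /esym/eqP := dot_perp_decomp u v (perp u); rewrite e scale0r addr_eq0 => /eqP vE.
exists (- dot (perp (perp u)) v / dot (perp u) (perp u)).
by rewrite [_ / _]mulrC -scalerA scaleNr -vE scalerA mulVf // scale1r.
Qed.

Lemma dot_perpZ u (c : R) : dot (perp u) (c *: u) = 0.
Proof. by rewrite dot_perpE !mxE; ring. Qed.

(** Unlike [is_polar_angle], the angle is not confined to one turn, so sectors may cross the angle
    0. *)
Definition has_direction v t : Prop :=
  exists2 r : R, 0 < r & v 0 0 = r * cos t /\ v 0 1 = r * sin t.

Lemma has_directionD2pi v t : has_direction v t -> has_direction v (t + 2 * pi).
Proof. by move=> [r r0 e]; exists r => //; rewrite mulr_natl cosD2pi sinD2pi. Qed.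

Lemma has_directionB2pi v t : has_direction v t -> has_direction v (t - 2 * pi).
Proof.
move=> [r r0 e]; exists r => //.
by rewrite -(cosD2pi (t - _)) -(sinD2pi (t - _)) -[pi *+ 2]mulr_natl subrK.
Qed.

Lemma has_direction_polar v : v != 0 -> has_direction v (polar_angle v).
Proof. by move=> /polar_angleP[]. Qed.

Lemma has_direction_antiparallel u v s :
  u != 0 -> has_direction u s -> has_direction v (s + pi) -> antiparallel u v.
Proof.
move=> u0 [r r0 [u0E u1E]] [q q0 [v0E v1E]]; split=> //.
exists (q / r); first exact: divr_gt0.
by apply: row2P; rewrite mxE ?u0E ?u1E ?v0E ?v1E ?cosDpi ?sinDpi; field; exact: lt0r_neq0.
Qed.

(** In polar form the determinant is the product of the two lengths and [sin (s - t)]. *)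
Lemma has_direction_dot_perp_ge0 u v s t :
  has_direction u s -> has_direction v t -> 0 <= sin (s - t) ->
  0 <= dot (perp u) v.
Proof.
move=> [r r0 [u0E u1E]] [q q0 [v0E v1E]]; rewrite sinB => st0.
rewrite dot_perpE u0E u1E v0E v1E.
have -> : r * sin s * (q * cos t) - r * cos s * (q * sin t) =
          r * q * (sin s * cos t - cos s * sin t) by ring.
by rewrite mulr_ge0 // mulr_ge0 // ltW.
Qed.

(** Cramer's rule in polar form: the coefficients are quotients of sines of angle differences, and
    an opening below [pi] keeps these differences in the range where the sine has the right sign. *)
Lemma has_direction_sector u w v (alpha beta t : R) :
  has_direction u alpha -> has_direction w beta -> has_direction v t ->
  alpha <= t < beta -> beta - alpha < pi ->
  exists x y, [/\ 0 <= x, 0 <= y & v = x *: u + y *: w].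
Proof.
move=> [p p0 [u0E u1E]] [q q0 [w0E w1E]] [r r0 [v0E v1E]] /andP[at_ tb] ba.
have sba : 0 < sin (beta - alpha) by apply: sin_gt0_pi; apply/andP; split; lra.
have sbt : 0 < sin (beta - t) by apply: sin_gt0_pi; apply/andP; split; lra.
have sta : 0 <= sin (t - alpha) by apply: sin_ge0_pi; apply/andP; split; lra.
exists (r * sin (beta - t) / (p * sin (beta - alpha))).
exists (r * sin (t - alpha) / (q * sin (beta - alpha))).
split; try by rewrite divr_ge0 ?mulr_ge0 // ltW.
move: (lt0r_neq0 sba) (lt0r_neq0 p0) (lt0r_neq0 q0) => sba0 p00 q00.
by apply: row2P; rewrite !mxE ?u0E ?u1E ?v0E ?v1E ?w0E ?w1E; move: sba0;
  rewrite !sinB => sba0; field; rewrite sba0 q00.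
Qed.

End PlaneVectors.

(** * Cones, their faces, and the line and half-plane cases *)

Section Cones.
Context {R : realType} {J : finType}.
Implicit Types (a : J -> 'rV[R]_2) (K : {set J}) (u v n : 'rV[R]_2).

Lemma coneD a K u v : cone a K u -> cone a K v -> cone a K (u + v).
Proof.
move=> [mu [mu0 ->]] [nu [nu0 ->]]; exists (fun k => mu k + nu k); split.
  by move=> k kK; rewrite addr_ge0 ?mu0 ?nu0.
by rewrite -big_split; apply: eq_bigr => k _; rewrite scalerDl.
Qed.

Lemma coneZ a K (c : R) v : 0 <= c -> cone a K v -> cone a K (c *: v).
Proof.
move=> c0 [mu [mu0 ->]]; exists (fun k => c * mu k); split.
  by move=> k kK; rewrite mulr_ge0 ?mu0.
by rewrite scaler_sumr; apply: eq_bigr => k _; rewrite scalerA.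
Qed.

Lemma cone0 a K : cone a K 0.
Proof.
by exists (fun=> 0); split=> //; rewrite big1 // => k _; rewrite scale0r.
Qed.

Lemma cone_mem a K k : k \in K -> cone a K (a k).
Proof.
move=> kK; exists (fun i => (i == k)%:R); split=> [i _|]; first exact: ler0n.
rewrite (bigD1 k) //= eqxx scale1r big1 ?addr0 // => i /andP[_ /negbTE ->].
by rewrite scale0r.
Qed.

Lemma cone_trans a K L v :
  (forall k, k \in K -> cone a L (a k)) -> cone a K v -> cone a L v.
Proof.
move=> KL [mu [mu0 ->]]; elim/big_ind: _ => [|x y|k kK]; first exact: cone0.
  exact: coneD.
by apply: coneZ; [apply: mu0|apply: KL].
Qed.

(** A negative multiple of [a j] is a positive multiple of [a k]. *)
Lemma cone_antiparallel a K j k (c : R) :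
  antiparallel (a j) (a k) -> j \in K -> k \in K -> cone a K (c *: a j).
Proof.
move=> [_ [d d0 akE]] jK kK; have [c0|c0] := leP 0 c.
  by apply: coneZ => //; exact: cone_mem.
have -> : c *: a j = (- c / d) *: a k.
  by rewrite akE scalerA; congr (_ *: _); field; exact: lt0r_neq0.
by apply: coneZ; [rewrite divr_ge0 ?oppr_ge0 // ltW|exact: cone_mem].
Qed.

Lemma cone_dot_gt0 a K n v :
  cone a K v -> 0 < dot n v -> exists2 k, k \in K & 0 < dot n (a k).
Proof.
move=> [mu [mu0 ->]]; rewrite dot_sumr => pos.
apply/exists_inP; apply: contraLR pos; rewrite negb_exists_in => /forall_inP neg.
rewrite -leNgt; apply: sumr_le0 => k kK.
by rewrite dotZr mulr_ge0_le0 ?mu0 // leNgt neg.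
Qed.

Lemma cone_dot_ge0 a K n v :
  (forall k, k \in K -> 0 <= dot n (a k)) -> cone a K v -> 0 <= dot n v.
Proof.
move=> n0 [mu [mu0 ->]]; rewrite dot_sumr; apply: sumr_ge0 => k kK.
by rewrite dotZr mulr_ge0 ?mu0 ?n0.
Qed.

(** A vanishing sum of nonnegative terms has only zero terms, so every generator off the kernel of
    [dot n] carries the coefficient 0. *)
Lemma cone_face a K n v :
  (forall k, 0 <= dot n (a k)) -> cone a K v -> dot n v = 0 ->
  cone a [set k in K | dot n (a k) == 0] v.
Proof.
move=> n0 [mu [mu0 ->]]; rewrite dot_sumr => /eqP.
rewrite psumr_eq0; last by move=> k kK; rewrite dotZr mulr_ge0 ?mu0.
move=> /allP z; exists mu; split; first by move=> k; rewrite inE => /andP[/mu0].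
rewrite [RHS](eq_bigl (fun k => (k \in K) && (dot n (a k) == 0))); last first.
  by move=> k; rewrite inE.
rewrite [RHS]big_mkcondr; apply: eq_bigr => k kK; case: ifPn => // nk0.
have := z k; rewrite mem_index_enum kK dotZr mulf_eq0 (negbTE nk0) orbF => /(_ isT).
by move=> /eqP ->; rewrite scale0r.
Qed.

Lemma cone_covering_setT a : cone_covering a [set: J].
Proof. by move=> j; apply: cone_mem; rewrite inE. Qed.

Lemma cone_covering_cone a K v :
  cone_covering a K -> cone a [set: J] v -> cone a K v.
Proof. by move=> cov; apply: cone_trans => k _; exact: cov. Qed.

Lemma cone_collinear_line a j k :
  collinear a -> antiparallel (a j) (a k) ->
  cone a [set: J] = [set v | exists c : R, v = c *: a j]%classic.
Proof.
move=> [u u0 au] ajk; have aj0 : a j != 0 by case: ajk.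
apply/seteqP; split=> v /=; last first.
  by move=> [c ->]; apply: (cone_antiparallel _ ajk); rewrite inE.
move=> [mu [mu0 ->]]; have [c ajE] := au j.
have c0 : c != 0 by apply: contra aj0 => /eqP e; rewrite ajE e scale0r.
elim/big_ind: _ => [|_ _ [x ->] [y ->]|i _].
- by exists 0; rewrite scale0r.
- by exists (x + y); rewrite scalerDl.
have [d ->] := au i; exists (mu i * d / c).
by rewrite ajE !scalerA divfK.
Qed.

Lemma collinear_cone_covering a j k K :
  collinear a -> antiparallel (a j) (a k) -> j \in K -> k \in K ->
  cone_covering a K.
Proof.
move=> col ajk jK kK i; have := cone_covering_setT a i.
rewrite (cone_collinear_line col ajk) => -[c ->].
exact: cone_antiparallel ajk jK kK.
Qed.

Lemma not_collinear_dot_perp a j :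
  a j != 0 -> ~ collinear a -> exists i, dot (perp (a j)) (a i) != 0.
Proof.
move=> aj0 ncol; apply/not_existsP => z; apply: ncol; exists (a j) => // i.
by apply: dot_perp_eq0 => //; apply/eqP/negPn/negP; exact: z.
Qed.

Lemma cone_half_plane a j k :
  antiparallel (a j) (a k) -> (forall i, 0 <= dot (perp (a j)) (a i)) ->
  ~ collinear a ->
  cone a [set: J] = [set v | 0 <= dot (perp (a j)) v]%classic.
Proof.
move=> ajk half ncol; have aj0 : a j != 0 by case: ajk.
have [i i0] := not_collinear_dot_perp aj0 ncol.
apply/seteqP; split=> v /=.
  by move=> vc; apply: cone_dot_ge0 vc => l _.
set d := dot (perp (a j)) => v0.
(* This is [dot_perp_decomp] divided by [d (a i)]. The first coefficient is nonnegative; the second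
   may have any sign, which the antiparallel pair absorbs. *)
have -> : v = (d v / d (a i)) *: a i + (dot (perp v) (a i) / d (a i)) *: a j.
  rewrite ![_ / _]mulrC -!scalerA -scalerDr -dot_perp_decomp scalerA.
  by rewrite mulVf // scale1r.
apply: coneD; last by apply: (cone_antiparallel _ ajk); rewrite inE.
by apply: coneZ; [rewrite divr_ge0 ?half|apply: cone_mem; rewrite inE].
Qed.

(* A covering family needs a member off the boundary line, and, since the
   boundary is a face, a member on each of its two rays. *)
Lemma half_plane_cone_covering_card a j k K :
  antiparallel (a j) (a k) -> (forall i, 0 <= dot (perp (a j)) (a i)) ->
  ~ collinear a -> cone_covering a K -> (3 <= #|K|)%N.
Proof.
move=> ajk half ncol cov; have aj0 : a j != 0 by case: ajk.
have [i i0] := not_collinear_dot_perp aj0 ncol.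
have [|p pK p0] := cone_dot_gt0 (n := perp (a j)) (cov i).
  by rewrite lt0r i0 half.
have jj0 : dot (perp (a j)) (a j) = 0 by rewrite -[X in dot _ X]scale1r dot_perpZ.
have jk0 : dot (perp (a j)) (a k) = 0.
  by have [_ [c _ ->]] := ajk; rewrite dot_perpZ.
(* On the boundary line, the inner product with [a j] tells the two rays apart: [q] is found on the
   ray of [a j], and [r] on that of [a k]. *)
have [|q] := cone_dot_gt0 (n := a j) (cone_face half (cov j) jj0).
  exact: dot_gt0.
rewrite inE => /andP[qK /eqP qz] q0.
have [|r] := cone_dot_gt0 (n := - a j) (cone_face half (cov k) jk0).
  have [_ [c c0 ->]] := ajk; rewrite dotZr /dot mulNmx mxE mulrNN.
  by rewrite mulr_gt0 //; exact: dot_gt0.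
rewrite inE => /andP[rK /eqP rz]; rewrite /dot mulNmx mxE oppr_gt0 => r0.
have qr : q != r by apply: contraTneq q0 => ->; rewrite -leNgt ltW.
have pq : p != q by apply: contraTneq p0 => ->; rewrite qz ltxx.
have pr : p != r by apply: contraTneq p0 => ->; rewrite rz ltxx.
have <- : #|[set p; q; r]| = 3%N.
  by rewrite finset.setUC cardsU1 cards2 !inE negb_or !(eq_sym r) pq pr qr.
by apply/subset_leq_card/fintype.subsetP => x; rewrite !inE -orbA => /or3P[]/eqP->.
Qed.

End Cones.

(** * From angular gaps to cones *)

Section AngularGaps.
Context {R : realType} {J : finType}.
Implicit Types (a : J -> 'rV[R]_2) (s : seq R).

Lemma angular_gaps_bracket s (t : R) :
  (0 < size s)%N -> sorted <=%R s -> (forall x, x \in s -> 0 <= x < 2 * pi) ->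
  0 <= t < 2 * pi ->
  exists alpha beta : R,
    [/\ alpha <= t < beta, beta - alpha \in angular_gaps s,
        alpha \in s \/ alpha + 2 * pi \in s & beta \in s \/ beta - 2 * pi \in s].
Proof.
move=> s0 srt rng /andP[t0 t2]; set P := fun x => t < x.
have hs : head 0 s \in s by rewrite -nth0 mem_nth.
have ls : last 0 s \in s by rewrite -nth_last mem_nth // prednK.
have gl : head 0 s + 2 * pi - last 0 s \in angular_gaps s.
  by rewrite mem_rcons inE eqxx.
(* [find] locates the first angle beyond [t]. At index 0 the wrap-around gap is used, with its start
   moved back by a turn; if no angle is beyond [t], it is used with its end moved forward by a
   turn. *)
case e : (find P s) => [|l].
  exists (last 0 s - 2 * pi), (head 0 s).
  have : t < head 0 s by rewrite -nth0 -e; apply: nth_find; rewrite has_find e.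
  have /andP[_ ?] := rng _ ls.
  move=> ?; split; first by apply/andP; split; lra.
  - by rewrite opprB addrA.
  - by right; rewrite subrK.
  - by left.
have before m : (m <= l)%N -> nth 0 s m <= t.
  by move=> ml; rewrite leNgt; apply/negbT/before_find; rewrite e.
have [hP|hP] := boolP (has P s).
  have lt : (l.+1 < size s)%N by rewrite -e -has_find.
  exists s`_l, s`_l.+1; split.
  - by rewrite before //=; rewrite -e; exact: (nth_find 0 hP).
  - rewrite mem_rcons inE; apply/orP; right.
    by apply/mapP; exists l => //; rewrite mem_iota /= add0n -ltnS prednK.
  - by left; rewrite mem_nth // ltnW.
  - by left; rewrite mem_nth.
exists (last 0 s), (head 0 s + 2 * pi); split=> //.
- move: hP; rewrite has_find -leqNgt e => le.
  have -> : last 0 s <= t by rewrite -nth_last before // -ltnS prednK // -e find_size.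
  by have /andP[? _] := rng _ hs; rewrite /=; lra.
- by left.
- by right; rewrite addrK.
Qed.

(** By monotonicity no entry falls strictly inside a gap. The second alternative is the wrap-around
    gap: it starts at the last entry, and its end, reduced by a turn, is the first one. *)
Lemma angular_gaps_separated s (g : R) :
  (0 < size s)%N -> sorted <=%R s -> g \in angular_gaps s ->
  (exists x, [/\ x \in s, x + g \in s &
     forall y, y \in s -> y <= x \/ x + g <= y]) \/
  (exists x, [/\ x \in s, x + g - 2 * pi \in s &
     forall y, y \in s -> x + g - 2 * pi <= y <= x]).
Proof.
move=> s0 srt; have mono := sorted_leq_nth le_trans le_refl 0 srt.
rewrite mem_rcons inE => /predU1P[->|/mapP[l]].
  right; exists (last 0 s); have -> : last 0 s + (head 0 s + 2 * pi - last 0 s) - 2 * pi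
    = head 0 s by ring.
  rewrite -nth0 -nth_last; split; rewrite ?mem_nth ?prednK //.
  move=> y /(nthP 0)[m ms <-].
  by rewrite !mono ?inE ?prednK // -ltnS prednK.
rewrite mem_iota /= add0n => ls -> ; left.
have l1s : (l.+1 < size s)%N by rewrite -(prednK s0) ltnS.
exists s`_l; rewrite addrC subrK; split; rewrite ?mem_nth // 1?ltnW //.
move=> y /(nthP 0)[m ms <-]; case: (leqP m l) => ml; [left|right];
  by rewrite mono ?inE // ltnW.
Qed.

Lemma mem_sorted_angles a j : polar_angle (a j) \in sorted_angles a.
Proof. by rewrite mem_sort; apply/mapP; exists j; rewrite ?mem_enum. Qed.

Lemma sorted_anglesP a x :
  x \in sorted_angles a -> exists j, x = polar_angle (a j).
Proof. by rewrite mem_sort => /mapP[j _ ->]; exists j. Qed.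

Lemma size_sorted_angles a : size (sorted_angles a) = #|J|.
Proof. by rewrite size_sort size_map -cardE. Qed.

Lemma sorted_angles_sorted a : sorted <=%R (sorted_angles a).
Proof. exact: sort_le_sorted. Qed.

Lemma le_largest_gap a g :
  g \in angular_gaps (sorted_angles a) -> g <= largest_gap a.
Proof. by move=> gin; exact: (@le_bigmax_seq _ _ _ _ 0 g xpredT id gin). Qed.

(** The maximum is either the initial value 0 or an actual gap; positivity excludes the former. *)
Lemma largest_gap_mem a :
  0 < largest_gap a -> largest_gap a \in angular_gaps (sorted_angles a).
Proof.
set s := angular_gaps _; suff [->|//] : largest_gap a = 0 \/ largest_gap a \in s.
  by rewrite ltxx.
rewrite /largest_gap -/s big_seq; elim/big_ind: _ => [|x y hx hy|i]; first by left.
  by rewrite /Num.max; case: ifP.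
by right.
Qed.

Lemma largest_gap_cone_setT a :
  (0 < #|J|)%N -> (forall j, a j != 0) -> largest_gap a < pi ->
  cone a [set: J] = setT.
Proof.
move=> J0 a0 G; apply/seteqP; split=> // v _.
have [->|v0] := eqVneq v 0; first exact: cone0.
have [t02 vt] := polar_angleP v0.
have [|||alpha [beta [ab gab alphaS betaS]]] :=
    angular_gaps_bracket (s := sorted_angles a) _ _ _ t02.
- by rewrite size_sorted_angles.
- exact: sorted_angles_sorted.
- by move=> x /sorted_anglesP[j ->]; have [] := polar_angleP (a0 j).
have [j aj] : exists j, has_direction (a j) alpha.
  case: alphaS => /sorted_anglesP[j e]; exists j; have := has_direction_polar (a0 j).
    by rewrite -e.
  by rewrite -e => /has_directionB2pi; rewrite addrK.
have [k ak] : exists k, has_direction (a k) beta.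
  case: betaS => /sorted_anglesP[k e]; exists k; have := has_direction_polar (a0 k).
    by rewrite -e.
  by rewrite -e => /has_directionD2pi; rewrite subrK.
have [|x [y [x0 y0 ->]]] := has_direction_sector aj ak vt ab.
  by apply: le_lt_trans G; exact: le_largest_gap.
by apply: coneD; apply: coneZ => //; apply: cone_mem; rewrite inE.
Qed.

(** Counterclockwise, the gap starts at [a j] and ends at [a k], so each member lies at most [pi]
    clockwise from [a j], where the sine is nonnegative. *)
Lemma largest_gap_pi_half_plane a :
  (0 < #|J|)%N -> (forall j, a j != 0) -> largest_gap a = pi ->
  exists j k, antiparallel (a j) (a k) /\
    forall i, 0 <= dot (perp (a j)) (a i).
Proof.
move=> J0 a0 G; have pi0 := pi_gt0 R.
have := @largest_gap_mem a; rewrite G => /(_ pi0) gin.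
have rng i : 0 <= polar_angle (a i) < 2 * pi by have [] := polar_angleP (a0 i).
have dir i := has_direction_polar (a0 i).
have [||[x []]|[x []]] := angular_gaps_separated _ _ gin.
- by rewrite size_sorted_angles.
- exact: sorted_angles_sorted.
- move=> /sorted_anglesP[j xE] /sorted_anglesP[k yE] sep.
  have := dir j; rewrite -xE => dj.
  exists j, k; split; first by apply: (has_direction_antiparallel (a0 j) dj); rewrite yE.
  move=> i; apply: (has_direction_dot_perp_ge0 dj (dir i)).
  have /andP[i0 i2] := rng i; have := rng j; rewrite -xE => /andP[j0 j2].
  have := rng k; rewrite -yE => /andP[k0 k2].
  have [ix|ix] := sep _ (mem_sorted_angles a i).
    by apply: sin_ge0_pi; apply/andP; split; lra.
  (* Beyond the gap the angle difference is at most [-pi]; adding a turn brings it into the range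
     from 0 to [pi]. *)
  by rewrite -sinD2pi -[pi *+ 2]mulr_natl; apply: sin_ge0_pi; apply/andP; split; lra.
- move=> /sorted_anglesP[j xE] /sorted_anglesP[k yE] sep.
  have := dir j; rewrite -xE => dj.
  exists j, k; split.
    apply: (has_direction_antiparallel (a0 j) dj).
    by have := has_directionD2pi (dir k); rewrite -yE subrK.
  move=> i; apply: (has_direction_dot_perp_ge0 dj (dir i)).
  have /andP[? ?] := sep _ (mem_sorted_angles a i).
  by apply: sin_ge0_pi; apply/andP; split; lra.
Qed.

End AngularGaps.

(** * Termination of the selection procedure *)

Section Procedure.
Context {R : realType} {J : finType}.
Implicit Types (a : J -> 'rV[R]_2) (h : seq {set J}).
Context (sel : seq {set J} -> nat -> {set J}).
Context (sel_valid : valid_selector sel) (J_ge3 : (3 <= #|J|)%N).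

Lemma valid_selector_full h : sel h #|J| = [set: J].
Proof.
by apply/eqP; rewrite eqEcard finset.subsetT finset.cardsT sel_valid ?J_ge3 ?leqnn.
Qed.

(** At [K = #|J|] the candidate is the full set, which is never rejected, so no transition leads
    past this value. *)
Lemma reached_bounds a h K : reached a sel h K -> (3 <= K <= #|J|)%N.
Proof.
elim=> {h K} [|h K _ /andP[K3 KJ] ncov]; first by rewrite J_ge3.
rewrite (leqW K3) ltn_neqAle KJ andbT; apply/eqP => KE; apply: ncov.
rewrite KE valid_selector_full; exact: cone_covering_setT.
Qed.

Lemma accepted_exists a : exists h K, accepted_at a sel h K.
Proof.
suff next d h K : reached a sel h K -> (#|J| - K < d)%N ->
    exists h' K', accepted_at a sel h' K'.
  exact: next (reached_start a sel) (ltnSn _).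
elim: d h K => // d IH h K hK lt.
have [cov|ncov] := pselect (cone_covering a (sel h K)); first by exists h, K.
(* The bound at the next state gives [K < #|J|], so the truncated difference [#|J| - K] strictly
   decreases. *)
have hK1 := reached_next hK ncov; have /andP[_ KJ] := reached_bounds hK1.
apply: IH hK1 _.
by rewrite subnS -ltnS prednK // subn_gt0.
Qed.

End Procedure.

Theorem mainTheorem5 (R : realType) (J : finType) (a : J -> 'rV[R]_2)
    (J_nonempty : (0 < #|J|)%N) (a_neq0 : forall j : J, a j != 0)
    (G_le_pi : largest_gap a <= pi) :
  (* (i) *)
  (largest_gap a < pi ->
     cone a [set: J]%SET = setT
     /\ forall K : {set J}, cone_covering a K -> positively_span a K)
  /\
  (* (ii) *)
  (largest_gap a = pi ->
     (collinear a ->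
        is_line (cone a [set: J]%SET)
        /\ (exists j k : J, antiparallel (a j) (a k))
        /\ (forall (j k : J) (K : {set J}), antiparallel (a j) (a k) ->
              j \in K -> k \in K -> cone_covering a K))
     /\ (~ collinear a ->
        is_closed_half_plane (cone a [set: J]%SET)
        /\ forall K : {set J}, cone_covering a K -> (3 <= #|K|)%N))
  /\
  (* (iii) *)
  ((3 <= #|J|)%N ->
     forall sel : seq {set J} -> nat -> {set J}, valid_selector sel ->
       (exists (h : seq {set J}) (K : nat),
          accepted_at a sel h K /\ (K <= #|J|)%N)
       /\ (forall (h : seq {set J}) (K : nat),
             reached a sel h K -> (K <= #|J|)%N)
       /\ (forall h : seq {set J}, reached a sel h #|J| ->
             sel h #|J| = [set: J]%SET)
       /\ cone_covering a [set: J]%SET).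
Proof.
split; [|split].
- move=> G; have full := largest_gap_cone_setT J_nonempty a_neq0 G.
  split=> // K cov; apply/seteqP; split=> // v _.
  by apply: cone_covering_cone => //; rewrite full.
- move=> G.
  (* One pair serves both cases: [a j] spans the line when the family is collinear, and [perp (a j)]
     is the normal of the half-plane otherwise. *)
  have [j [k [ajk half]]] := largest_gap_pi_half_plane J_nonempty a_neq0 G.
  split=> col; split.
  + by exists (a j) => //; exact: cone_collinear_line ajk.
  + by split; [exists j, k|move=> j' k' K; exact: collinear_cone_covering].
  + exists (perp (a j)); first exact: perp_neq0.
    exact: cone_half_plane ajk half col.
  + by move=> K; exact: half_plane_cone_covering_card ajk half col.
- move=> J3 sel vsel; split; [|split; [|split]].
  + have [h [K hK]] := accepted_exists vsel J3 a; exists h, K; split=> //.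
    by have /andP[] := reached_bounds vsel J3 hK.1.
  + by move=> h K /(reached_bounds vsel J3)/andP[].
  + by move=> h _; exact: valid_selector_full.
  + exact: cone_covering_setT.
Qed.
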